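(* Let $M$ be a submanifold of a Sasakian manifold tangent to the Reeb vector field $\xi$. After the Reeb line $\langle\xi\rangle$ is separated, each of the following structures determines a PTR structure: (1) an anti-invariant submanifold; (2) a contact CR-submanifold; (3) a hemi-slant submanifold; (4) a pointwise hemi-slant submanifold. More precisely, the additional condition imposed on the ambiguous distribution is, respectively, totally real, invariant, slant, and pointwise slant.
   Context: A Sasakian manifold $(\overline M^{2m+1},\phi,\xi,\eta,g)$ consists of a Riemannian metric $g$ with Levi-Civita connection $\widetilde\nabla$, a $(1,1)$-tensor field $\phi$, a vector field $\xi$ (the Reeb vector field) and a 1-form $\eta$ with $\phi^2X=-X+\eta(X)\xi$, $\eta(\xi)=1$, $\phi\xi=0$, $g(\phi X,\phi Y)=g(X,Y)-\eta(X)\eta(Y)$ and $(\widetilde\nabla_X\phi)Y=g(X,Y)\xi-\eta(Y)X$. Let $M$ be an immersed submanifold with $\xi\in\Gamma(TM)$ and normal bundle $T^\perp M$. $M$ is a PTR (partially totally real) submanifold if there exists a nonzero constant-rank distribution $\mathcal D^{\perp}\subset TM\cap\ker\eta$ that is totally real, i.e. $\phi\mathcal D^{\perp}\subset T^{\perp}M$. The ambiguous distribution $\widetilde{\mathcal D}$ is the orthogonal complement of $\mathcal D^{\perp}\oplus\langle\xi\rangle$ in $TM$, so that $TM=\mathcal D^\perp\oplus\widetilde{\mathcal D}\oplus\langle\xi\rangle$; the PTR structure refers to this chosen decomposition. A distribution $D\subset TM\cap\ker\eta$ is totally real (anti-invariant) if $\phi D\subset T^\perp M$; invariant if $\phi D=D$;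 pointwise slant if for each point $p$ the angle $\theta(p)$ between $\phi X$ and $D_p$ is the same for all nonzero $X\in D_p$; slant if this angle is moreover independent of $p$. For $M$ tangent to $\xi$: $M$ is anti-invariant if $\phi(TM\cap\ker\eta)\subset T^\perp M$. $M$ is a contact CR-submanifold if $TM=D^\perp\oplus D\oplus\langle\xi\rangle$ orthogonally with $\phi D^\perp\subset T^\perp M$ and $\phi D=D$. $M$ is hemi-slant if $TM=D^\perp\oplus D_\theta\oplus\langle\xi\rangle$ orthogonally with $D^\perp$ anti-invariant and $D_\theta$ slant; it is pointwise hemi-slant if the same holds with $D_\theta$ pointwise slant, the constant angle being replaced by a smooth slant function $\theta(p)$.
   Formalization: The totally real distribution (in case (1), TM ∩ ker η) is assumed nonzero, as a PTR structure requires; without this the claim fails, e.g. for an invariant submanifold viewed as a contact CR-submanifold with zero totally real part. *)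

(* Defs.v *)
From HB Require Import structures.
From mathcomp Require Import all_boot all_order all_algebra.
From mathcomp Require Import all_classical all_reals all_analysis.

Set Implicit Arguments.
Unset Strict Implicit.
Unset Printing Implicit Defensive.

Import Order.TTheory GRing.Theory Num.Theory.
Import numFieldNormedType.Exports.

Local Open Scope classical_set_scope.
Local Open Scope ring_scope.

(* C^oo on the open set U: every iterated directional derivative of f is
   (Frechet) differentiable at every point of U. *)
Definition smooth_on (R : realType) (n : nat) (W : normedModType R)
    (U : set 'rV[R]_n) (f : 'rV[R]_n -> W) : Prop :=
  forall (vs : seq 'rV[R]_n) (x : 'rV[R]_n), U x ->
    differentiable (foldr (fun v h => 'D_v h) f vs) x.

(* Smooth manifolds without boundary; [chart i] and [chart_inv i] are total
   functions, meaningful on [chart_dom i] and on its image only.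
   The chart [chart_at p] around p serves to represent tangent vectors. *)
Record smooth_manifold (R : realType) (n : nat) := SmoothManifold {
  mfd_carrier :> topologicalType;
  mfd_hausdorff : hausdorff_space mfd_carrier;
  mfd_second_countable : @second_countable mfd_carrier;
  chart_index : Type;
  chart_dom : chart_index -> set mfd_carrier;
  chart : chart_index -> mfd_carrier -> 'rV[R]_n;
  chart_inv : chart_index -> 'rV[R]_n -> mfd_carrier;
  chart_dom_open : forall i, open (chart_dom i);
  chart_img_open : forall i, open (chart i @` chart_dom i);
  chartK : forall i p, chart_dom i p -> chart_inv i (chart i p) = p;
  chart_continuous : forall i p, chart_dom i p -> {for p, continuous (chart i)};
  chart_inv_continuous : forall i x, (chart i @` chart_dom i) x ->
    {for x, continuous (chart_inv i)};
  chart_transition : forall i j,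
    smooth_on (chart i @` (chart_dom i `&` chart_dom j))
              (chart j \o chart_inv i);
  chart_at : mfd_carrier -> chart_index;
  chart_atP : forall p, chart_dom (chart_at p) p }.

Section Manifolds.
Context {R : realType} {n : nat}.
Implicit Types (M : smooth_manifold R n).

Definition smooth_fun_on (W : normedModType R) M (O : set M) (h : M -> W) :=
  forall i : chart_index M,
    smooth_on (chart i @` (O `&` chart_dom i)) (h \o chart_inv i).

Definition smooth_map k M (N : smooth_manifold R k) (f : M -> N) :=
  continuous f /\
  forall (i : chart_index M) (j : chart_index N),
    smooth_on (chart i @` (chart_dom i `&` f @^-1` chart_dom j))
              (chart j \o f \o chart_inv i).

(* The tangent space at p is 'rV[R]_n: a row vector is the coordinate vector of
   a tangent vector in the chart [chart_at p]. Subspaces of it are the row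
   spaces of matrices (scope %MS), and linear maps act by *m on the right. *)

Definition tangent_map k M (N : smooth_manifold R k) (f : M -> N) (p : M) :
    'M[R]_(n, k) :=
  'J (chart (chart_at (f p)) \o f \o chart_inv (chart_at p))
     (chart (chart_at p) p).

(* coordinates in the chart i of the tangent vectors at p *)
Definition to_chart M (i : chart_index M) (p : M) : 'M[R]_n :=
  'J (chart i \o chart_inv (chart_at p)) (chart (chart_at p) p).

(* row k is the coordinate vector field d/dx^k of the chart i, at p *)
Definition chart_frame M (i : chart_index M) (p : M) : 'M[R]_n :=
  'J (chart (chart_at p) \o chart_inv i) (chart i p).

(* X . h, the derivative of the function h along the vector field X *)
Definition vf_act M (X : M -> 'rV[R]_n) (h : M -> R) (p : M) : R :=
  'D_(X p) (h \o chart_inv (chart_at p)) (chart (chart_at p) p).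

Definition smooth_vf_on M (O : set M) (X : M -> 'rV[R]_n) :=
  forall i : chart_index M,
    smooth_fun_on (O `&` chart_dom i) (fun p => X p *m to_chart i p).

Definition smooth_vf M (X : M -> 'rV[R]_n) := smooth_vf_on [set: M] X.

Definition smooth_1form M (eta : M -> 'cV[R]_n) :=
  forall i : chart_index M,
    smooth_fun_on (chart_dom i) (fun p => chart_frame i p *m eta p).

Definition smooth_endo M (phi : M -> 'M[R]_n) :=
  forall i : chart_index M,
    smooth_fun_on (chart_dom i)
      (fun p => chart_frame i p *m phi p *m to_chart i p).

Definition smooth_bilin M (g : M -> 'M[R]_n) :=
  forall i : chart_index M,
    smooth_fun_on (chart_dom i)
      (fun p => chart_frame i p *m g p *m (chart_frame i p)^T).

Definition ev1 M (eta : M -> 'cV[R]_n) (p : M) (v : 'rV[R]_n) : R :=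
  (v *m eta p) 0 0.

Definition ev2 M (g : M -> 'M[R]_n) (p : M) (v w : 'rV[R]_n) : R :=
  (v *m g p *m w^T) 0 0.

Definition riemannian_metric M (g : M -> 'M[R]_n) :=
  [/\ smooth_bilin g,
      forall p v w, ev2 g p v w = ev2 g p w v &
      forall p v, v != 0 -> 0 < ev2 g p v v].

(* Torsion-freeness nabla_X Y - nabla_Y X = [X, Y] is expressed through the
   action of both sides on functions. *)
Definition levi_civita M (g : M -> 'M[R]_n)
    (nabla : (M -> 'rV[R]_n) -> (M -> 'rV[R]_n) -> M -> 'rV[R]_n) :=
  (forall X Y, smooth_vf X -> smooth_vf Y -> smooth_vf (nabla X Y)) /\
  (forall X X' Y, smooth_vf X -> smooth_vf X' -> smooth_vf Y -> forall p,
      nabla (fun q => X q + X' q) Y p = nabla X Y p + nabla X' Y p) /\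
  (forall (h : M -> R) X Y, smooth_fun_on [set: M] h ->
      smooth_vf X -> smooth_vf Y -> forall p,
      nabla (fun q => h q *: X q) Y p = h p *: nabla X Y p) /\
  (forall X Y Y', smooth_vf X -> smooth_vf Y -> smooth_vf Y' -> forall p,
      nabla X (fun q => Y q + Y' q) p = nabla X Y p + nabla X Y' p) /\
  (forall (h : M -> R) X Y, smooth_fun_on [set: M] h ->
      smooth_vf X -> smooth_vf Y -> forall p,
      nabla X (fun q => h q *: Y q) p
        = vf_act X h p *: Y p + h p *: nabla X Y p) /\
  (forall (h : M -> R) X Y, smooth_fun_on [set: M] h ->
      smooth_vf X -> smooth_vf Y -> forall p,
      vf_act (fun q => nabla X Y q - nabla Y X q) h p
        = vf_act X (vf_act Y h) p - vf_act Y (vf_act X h) p) /\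
  (forall X Y Z, smooth_vf X -> smooth_vf Y -> smooth_vf Z -> forall p,
      vf_act X (fun q => ev2 g q (Y q) (Z q)) p
        = ev2 g p (nabla X Y p) (Z p) + ev2 g p (Y p) (nabla X Z p)).

End Manifolds.

Record sasakian_manifold (R : realType) (m : nat) := SasakianManifold {
  sas_mfd :> smooth_manifold R (2 * m).+1;
  sas_g : sas_mfd -> 'M[R]_((2 * m).+1);
  sas_phi : sas_mfd -> 'M[R]_((2 * m).+1);
  sas_xi : sas_mfd -> 'rV[R]_((2 * m).+1);
  sas_eta : sas_mfd -> 'cV[R]_((2 * m).+1);
  sas_nabla : (sas_mfd -> 'rV[R]_((2 * m).+1)) ->
              (sas_mfd -> 'rV[R]_((2 * m).+1)) ->
              sas_mfd -> 'rV[R]_((2 * m).+1);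
  sas_metric : riemannian_metric sas_g;
  sas_phi_smooth : smooth_endo sas_phi;
  sas_xi_smooth : smooth_vf sas_xi;
  sas_eta_smooth : smooth_1form sas_eta;
  sas_levi_civita : levi_civita sas_g sas_nabla;
  sas_phi2 : forall p v,
    v *m sas_phi p *m sas_phi p = - v + ev1 sas_eta p v *: sas_xi p;
  sas_eta_xi : forall p, ev1 sas_eta p (sas_xi p) = 1;
  sas_phi_xi : forall p, sas_xi p *m sas_phi p = 0;
  sas_compat : forall p v w,
    ev2 sas_g p (v *m sas_phi p) (w *m sas_phi p)
      = ev2 sas_g p v w - ev1 sas_eta p v * ev1 sas_eta p w;
  (* (nabla_X phi) Y = nabla_X (phi Y) - phi (nabla_X Y) *)
  sas_nabla_phi : forall X Y, smooth_vf X -> smooth_vf Y -> forall p,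
    sas_nabla X (fun q => Y q *m sas_phi q) p - sas_nabla X Y p *m sas_phi p
      = ev2 sas_g p (X p) (Y p) *: sas_xi p - ev1 sas_eta p (Y p) *: X p }.

Record immersed_submanifold (R : realType) (n k : nat)
    (N : smooth_manifold R k) := ImmersedSubmanifold {
  sub_mfd :> smooth_manifold R n;
  sub_incl : sub_mfd -> N;
  sub_smooth : smooth_map sub_incl;
  sub_immersion : forall p, row_free (tangent_map sub_incl p) }.

Section Submanifolds.
Context {R : realType} {m n : nat} {Mbar : sasakian_manifold R m}.
Variable M : immersed_submanifold n Mbar.
Local Notation N := ((2 * m).+1).
Local Notation incl := (@sub_incl _ _ _ _ M).

(* From now on subspaces of the tangent space of M at p are identified with
   their images in the tangent space of Mbar at [incl p]. *)

Definition TM (p : M) : 'M[R]_(n, N) := tangent_map incl p.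

Definition phi_at (p : M) : 'M[R]_N := sas_phi (incl p).
Definition xi_at (p : M) : 'rV[R]_N := sas_xi (incl p).
Definition g_at (p : M) (v w : 'rV[R]_N) : R := ev2 (@sas_g _ _ Mbar) (incl p) v w.

(* g-orthogonal complement of W in the tangent space of Mbar *)
Definition orth k (p : M) (W : 'M[R]_(k, N)) : 'M[R]_N :=
  kermx (sas_g (incl p) *m W^T).

Definition normal_space (p : M) : 'M[R]_N := orth p (TM p).

Definition reeb_tangent := forall p, (xi_at p <= TM p)%MS.

(* TM \cap ker eta *)
Definition contact_part (p : M) : 'M[R]_N :=
  (TM p :&: kermx (sas_eta (incl p)))%MS.

(* Constant-rank smooth subbundle of TM: around every point it has a frame made
   of smooth vector fields of M, the rows of X. *)
Definition smooth_distribution (D : M -> 'M[R]_N) :=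
  exists r : nat, forall p : M, exists (O : set M) (X : M -> 'M[R]_(r, n)),
    [/\ open O, O p,
        forall i, smooth_vf_on O (fun q => row i (X q)) &
        forall q, O q -> \rank (D q) = r /\ (D q :=: X q *m TM q)%MS].

Definition nonzero_distribution (D : M -> 'M[R]_N) := exists p, D p != 0.

Definition totally_real (D : M -> 'M[R]_N) :=
  forall p, (D p *m phi_at p <= normal_space p)%MS.

Definition phi_invariant (D : M -> 'M[R]_N) :=
  forall p, (D p *m phi_at p :=: D p)%MS.

(* Angle between v and the subspace W, i.e., between v and its orthogonal
   projection onto W. *)
Definition angle (p : M) (v : 'rV[R]_N) (W : 'M[R]_N) : R :=
  let w := v *m proj_mx W (orth p W) in
  acos (Num.sqrt (g_at p w w) / Num.sqrt (g_at p v v)).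

Definition pointwise_slant (D : M -> 'M[R]_N) (theta : M -> R) :=
  forall p (v : 'rV[R]_N), (v <= D p)%MS -> v != 0 ->
    angle p (v *m phi_at p) (D p) = theta p.

Definition slant (D : M -> 'M[R]_N) (theta : R) :=
  pointwise_slant D (fun=> theta).

Definition ptr (Dperp : M -> 'M[R]_N) :=
  [/\ smooth_distribution Dperp, nonzero_distribution Dperp,
      forall p, (Dperp p <= contact_part p)%MS & totally_real Dperp].

Definition ambiguous (Dperp : M -> 'M[R]_N) (p : M) : 'M[R]_N :=
  (TM p :&: orth p (Dperp p + xi_at p)%MS)%MS.

Definition anti_invariant := totally_real contact_part.

(* TM = Dperp (+) D (+) <xi>, an orthogonal decomposition into distributions *)
Definition orth_decomposition (Dperp D : M -> 'M[R]_N) :=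
  smooth_distribution Dperp /\ smooth_distribution D /\
  forall p, [/\ (TM p :=: Dperp p + D p + <<xi_at p>>)%MS,
    mxdirect (Dperp p + D p + <<xi_at p>>),
    (Dperp p <= orth p (D p))%MS, (Dperp p <= orth p (xi_at p))%MS &
    (D p <= orth p (xi_at p))%MS].

Definition contact_CR (Dperp D : M -> 'M[R]_N) :=
  [/\ orth_decomposition Dperp D, totally_real Dperp & phi_invariant D].

Definition hemi_slant (Dperp D : M -> 'M[R]_N) (theta : R) :=
  [/\ orth_decomposition Dperp D, totally_real Dperp & slant D theta].

Definition pointwise_hemi_slant (Dperp D : M -> 'M[R]_N) (theta : M -> R) :=
  [/\ orth_decomposition Dperp D, totally_real Dperp,
      pointwise_slant D theta & smooth_fun_on [set: M] theta].

End Submanifolds.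

(* Main.v *)
Require Import Defs.
From HB Require Import structures.
From mathcomp Require Import all_boot all_order all_algebra.
From mathcomp Require Import all_classical all_reals all_analysis.

Set Implicit Arguments.
Unset Strict Implicit.
Unset Printing Implicit Defensive.

Import Order.TTheory GRing.Theory Num.Theory.
Import numFieldNormedType.Exports.

Local Open Scope classical_set_scope.
Local Open Scope ring_scope.

(** Once the Reeb line is split off, a contact CR, hemi-slant or pointwise
    hemi-slant structure is a totally real distribution [Dperp] together with a
    second one, [D]. Two facts reduce it to a PTR structure: an orthogonal
    decomposition TM = Dperp + D + <xi> leaves no choice for [D], which must be
    the ambiguous distribution of [Dperp], and conversely the ambiguous
    distribution always yields such a decomposition. The extra condition
    (invariant, slant, pointwise slant) is then the same on both sides. In the
    anti-invariant case TM \cap ker eta = Dperp + ambiguous, so it is totally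
    real exactly when both summands are.

    The first fact and the orthogonal splitting are linear algebra in one tangent
    space. The Sasakian identities enter only through eta = g(., xi)
    ([sas_eta_metric]), which turns ker eta into the orthogonal complement of xi;
    positivity of g makes a subspace and its orthogonal complement split the
    whole space ([sub_add_orth], [orth_split]).

    The analytic content is that the ambiguous distribution is again a smooth
    distribution ([ambiguous_smooth]). In charts of M and of the ambient manifold
    it is the kernel of a smooth matrix of constant rank, namely the Gram matrix
    pairing the coordinate frame of M with a frame of Dperp + <xi>. The kernel
    of a smooth matrix of constant rank has smooth local frames
    ([smooth_kernel_frame]), given by an explicit formula that is polynomial in
    the entries of the matrix. Taking the zero distribution
    for [Dperp] shows that TM \cap ker eta is itself smooth, which is what the
    anti-invariant case needs.

    The calculus behind this (stability of smooth maps under products,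
    composition and Jacobians) is obtained by induction on the order of
    differentiability, [Ck_on], since smoothness is given by iterated
    directional derivatives; the chain rule in charts ([jacobian_charts])
    relates tangent vectors written in different charts. *)

(** * Differential calculus of maps between row vectors *)

Section DifferentialCalculus.
Context {R : realType}.

(** The difference of f and g vanishes near x, so the
    linear approximation of f at x also serves for g. *)
Lemma differentiable_near_eq (V W : normedModType R) (f g : V -> W) (x : V) :
  (\near x, f x = g x) -> differentiable f x -> differentiable g x.
Proof.
move=> fg df; apply/diff_locallyP.
have gE : g \o shift x = cst (g x) + 'd f x +o_ 0 id.
  apply/eqaddoP => _/posnumP[e].
  have [_ /eqaddoP/(_ e%:num)] := (diff_locallyP _ _).1 df.
  move=> /(_ [gt0 of e%:num]) fe.
  have fg0 : \forall h \near (0 : V), f (h + x) = g (h + x).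
    by move: fg; rewrite (near_shift 0 x); apply: filterS => y /=; rewrite subr0.
  near=> h.
  suff -> : (g \o shift x - (cst (g x) + 'd f x)) h =
            (f \o shift x - (cst (f x) + 'd f x)) h.
    by near: h.
  rewrite /= -[LHS]/(g (h + x) - (g x + 'd f x h)) -[RHS]/(f (h + x) - (f x + 'd f x h)).
  by rewrite (nbhs_singleton fg); congr (_ - _); apply/esym; near: h.
have cf : continuous ('d f x) by exact: diff_continuous.
by rewrite (diff_unique cf gE).
Unshelve. all: by end_near. Qed.

(** The converse direction writes f as the sum of its entries times the elementary
    matrices, each term being a scalar function times a fixed matrix. *)
Lemma differentiable_mxP (V : normedModType R) m n (f : V -> 'M[R]_(m, n)) x :
  differentiable f x <-> forall i j, differentiable (fun y => f y i j : R) x.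
Proof.
split=> [df i j|df].
  exact: (@differentiable_comp _ _ _ _ f (fun N : 'M[R]_(m, n) => N i j : R)
            _ df (differentiable_coord _ _ _)).
have -> : f = fun y => \sum_i \sum_j f y i j *: delta_mx i j.
  by apply/funext => y; rewrite {1}(matrix_sum_delta (f y)).
have sumE (k : nat) (h : 'I_k -> V -> 'M[R]_(m, n)) :
    (fun y => \sum_i h i y) = \sum_i h i.
  by apply/funext => y; rewrite fct_sumE.
rewrite sumE; apply: differentiable_sum => i.
rewrite sumE; apply: differentiable_sum => j.
exact: differentiableZl.
Qed.

Lemma derive_mxE n p q (f : 'rV[R]_n -> 'M[R]_(p, q)) v x i j :
  differentiable f x -> ('D_v f x) i j = 'D_v (fun y => f y i j : R) x.
Proof. by move=> df; rewrite derive_mx ?mxE//; exact: diff_derivable. Qed.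

Lemma row_jacobian n p (f : 'rV[R]_n -> 'rV[R]_p) x i :
  differentiable f x -> row i ('J f x) = 'D_(delta_mx 0 i) f x.
Proof. by move=> df; rewrite rowE (deriveEjacobian _ df). Qed.

Lemma jacobian_comp n p q (f : 'rV[R]_n -> 'rV[R]_p) (h : 'rV[R]_p -> 'rV[R]_q) x :
  differentiable f x -> differentiable h (f x) ->
  'J (h \o f) x = 'J f x *m 'J h (f x).
Proof.
move=> df dh; apply/row_matrixP => i.
have dhf : differentiable (h \o f) x by exact: differentiable_comp.
rewrite row_mul (row_jacobian i dhf) (row_jacobian i df).
rewrite -(deriveEjacobian _ dh) (deriveE _ dhf) (deriveE _ df) (deriveE _ dh).
by rewrite (diff_comp df dh).
Qed.

Lemma jacobian_near_eq n p (f h : 'rV[R]_n -> 'rV[R]_p) x :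
  (\near x, f x = h x) -> differentiable f x -> 'J f x = 'J h x.
Proof.
move=> fh df; apply/row_matrixP => i.
have dh : differentiable h x.
  exact: differentiable_near_eq fh df.
have dE := near_eq_derive (delta_mx 0 i) fh.
exact: etrans (row_jacobian i df) (etrans dE (esym (row_jacobian i dh))).
Qed.

Lemma derive_comp n p (W : normedModType R) (f : 'rV[R]_n -> 'rV[R]_p)
    (h : 'rV[R]_p -> W) v x :
  differentiable f x -> differentiable h (f x) ->
  'D_v (h \o f) x = \sum_(j < p) ('D_v f x) 0 j *: 'D_(delta_mx 0 j) h (f x).
Proof.
move=> df dh; have dhf : differentiable (h \o f) x by exact: differentiable_comp.
rewrite (deriveE _ dhf) (deriveE _ df) (diff_comp df dh) /=.
rewrite {1}(row_sum_delta ('d f x v)) linear_sum.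
by apply: eq_bigr => j _; rewrite linearZ /= (deriveE _ dh).
Qed.

End DifferentialCalculus.

(** * Smooth maps on open sets *)

Section SmoothCalculus.
Context {R : realType} {n : nat}.
Implicit Types (U : set 'rV[R]_n) (W : normedModType R).

(** [smooth_on] iterates derivatives from the outside; peeling off the innermost
    one gives this recursive form, on which induction on the order is possible. *)
Fixpoint Ck_on W (k : nat) U (f : 'rV[R]_n -> W) : Prop :=
  (forall x, U x -> differentiable f x) /\
  if k is k'.+1 then forall v, Ck_on k' U ('D_v f) else True.

Lemma Ck_on_differentiable W k U (f : 'rV[R]_n -> W) :
  Ck_on k U f -> forall x, U x -> differentiable f x.
Proof. by case: k => [|k] []. Qed.

Lemma Ck_on_le W k U (f : 'rV[R]_n -> W) : Ck_on k.+1 U f -> Ck_on k U f.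
Proof.
elim: k f => [|k IH] f; first by case.
by move=> [df dfk]; split=> // v; exact: IH (dfk v).
Qed.

Lemma smooth_onP W U (f : 'rV[R]_n -> W) :
  smooth_on U f <-> forall k, Ck_on k U f.
Proof.
split=> [sf k|sf vs].
  elim: k f sf => [|k IH] f sf; split=> //; do ?[exact: (sf [::])].
  by move=> v; apply: IH => vs x Ux; have := sf (rcons vs v) x Ux; rewrite foldr_rcons.
elim/last_ind: vs f sf => [|vs v IH] f sf x Ux.
  exact: Ck_on_differentiable (sf 0) _ Ux.
rewrite foldr_rcons; apply: IH => // k.
by have [_] := sf k.+1; apply.
Qed.

(** Openness of U is what makes this true: a derivative at a point of U then only
    involves values on U. *)
Lemma Ck_on_eq W k U (f g : 'rV[R]_n -> W) : open U ->
  (forall x, U x -> f x = g x) -> Ck_on k U f -> Ck_on k U g.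
Proof.
move=> oU; have near_eq f' g' (x : 'rV[R]_n) :
    (forall x, U x -> f' x = g' x :> W) -> U x -> \near x, f' x = g' x.
  by move=> fg Ux; apply: filterS fg _; exact: open_nbhs_nbhs.
have deq f' g' : (forall x, U x -> f' x = g' x :> W) ->
    (forall x, U x -> differentiable f' x) ->
    (forall x, U x -> differentiable g' x).
  by move=> fg df x Ux; apply: differentiable_near_eq (near_eq _ _ _ fg Ux) (df _ Ux).
elim: k f g => [|k IH] f g fg [df sf]; (split; first exact: deq fg df) => // v.
apply: (IH ('D_v f)) (sf v) => x Ux.
exact: (near_eq_derive v (near_eq _ _ _ fg Ux)).
Qed.

Lemma Ck_on_cst W k U (a : W) : Ck_on k U (fun=> a).
Proof.
elim: k a => [|k IH] a; split => //.
move=> v; have -> : 'D_v (fun=> a) = (fun=> 0) :> ('rV[R]_n -> W); last exact: IH.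
by apply/funext => x; rewrite derive_cst.
Qed.

Lemma Ck_onD W k U (f g : 'rV[R]_n -> W) : open U ->
  Ck_on k U f -> Ck_on k U g -> Ck_on k U (fun x => f x + g x).
Proof.
move=> oU; elim: k f g => [|k IH] f g [df sf] [dg sg];
  (split; first by move=> x Ux; apply: differentiableD; [exact: df|exact: dg]) => // v.
apply: Ck_on_eq oU _ (IH _ _ (sf v) (sg v)) => x Ux.
by rewrite -deriveD//; apply: diff_derivable; [exact: df|exact: dg].
Qed.

(** By the Leibniz rule the derivative of a product is a sum of products of
    functions of order k, so the induction closes up. *)
Lemma Ck_onM k U (f g : 'rV[R]_n -> R) : open U ->
  Ck_on k U f -> Ck_on k U g -> Ck_on k U (fun x => f x * g x).
Proof.
move=> oU; elim: k f g => [|k IH] f g [df sf] [dg sg];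
  (split; first by move=> x Ux; apply: differentiableM; [exact: df|exact: dg]) => // v.
have cf : Ck_on k U f by apply: Ck_on_le.
have cg : Ck_on k U g by apply: Ck_on_le.
have := Ck_onD oU (IH _ _ cf (sg v)) (IH _ _ cg (sf v)).
apply: Ck_on_eq oU _ => x Ux.
by rewrite -deriveM//; apply: diff_derivable; [exact: df|exact: dg].
Qed.

Lemma Ck_on_sum k U (I : Type) (r : seq I) (P : pred I) (f : I -> 'rV[R]_n -> R) :
  open U -> (forall i, P i -> Ck_on k U (f i)) ->
  Ck_on k U (fun x => \sum_(i <- r | P i) f i x).
Proof.
move=> oU sf; elim: r => [|i r IH].
  by apply: Ck_on_eq oU _ (Ck_on_cst _ _ 0) => x _; rewrite big_nil.
have [Pi|/negbTE nPi] := boolP (P i).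
  by apply: Ck_on_eq oU _ (Ck_onD oU (sf i Pi) IH) => x _; rewrite big_cons Pi.
by apply: Ck_on_eq oU _ IH => x _; rewrite big_cons nPi.
Qed.

Lemma Ck_on_mxP k U p q (f : 'rV[R]_n -> 'M[R]_(p, q)) : open U ->
  Ck_on k U f <-> forall i j, Ck_on k U (fun x => f x i j : R).
Proof.
move=> oU; split; elim: k f => [|k IH] f.
- by move=> [df _] i j; split=> // x /df/differentiable_mxP.
- move=> [df sf] i j; split=> [x /df/differentiable_mxP//|v].
  by apply: Ck_on_eq oU _ (IH _ (sf v) i j) => x /df dfx; rewrite (derive_mxE v i j dfx).
- move=> sf; split=> // x Ux; apply/differentiable_mxP => i j.
  by case: (sf i j) => + _; apply.
- move=> sf.
  have df x : U x -> differentiable f x.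
    by move=> Ux; apply/differentiable_mxP => i j; case: (sf i j) => + _; apply.
  split=> // v; apply: IH => i j.
  case: (sf i j) => _ /(_ v).
  by apply: Ck_on_eq oU _ => x /df dfx; rewrite (derive_mxE v i j dfx).
Qed.


End SmoothCalculus.

Section SmoothOperations.
Context {R : realType}.

(** By the chain rule a derivative of h \o f is a sum of products of a coordinate of
    a derivative of f and of a partial derivative of h composed with f; the
    latter is C^k by induction. *)
Lemma Ck_on_comp n p k (U : set 'rV[R]_n) (V : set 'rV[R]_p)
    (f : 'rV[R]_n -> 'rV[R]_p) (h : 'rV[R]_p -> R) :
  open U -> (forall x, U x -> V (f x)) -> Ck_on k U f -> Ck_on k V h ->
  Ck_on k U (h \o f).
Proof.
move=> oU UV; elim: k h => [|k IH] h [df sf] [dh sh].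
  by split=> // x Ux; apply: differentiable_comp; [exact: df|exact: dh (UV _ Ux)].
split=> [x Ux|v].
  by apply: differentiable_comp; [exact: df|exact: dh (UV _ Ux)].
have cf : Ck_on k U f by exact: Ck_on_le.
have := @Ck_on_sum _ _ k U 'I_p (index_enum 'I_p) xpredT
  (fun j x => ('D_v f x) 0 j * 'D_(delta_mx 0 j) h (f x)) oU.
have hj j : Ck_on k U (fun x => ('D_v f x) 0 j * 'D_(delta_mx 0 j) h (f x)).
  apply: Ck_onM => //; first by have /(Ck_on_mxP k _ oU) := sf v; apply.
  exact: IH cf (sh _).
move=> /(_ (fun j _ => hj j)); apply: Ck_on_eq oU _ => x Ux.
by rewrite (derive_comp v (df x Ux) (dh _ (UV _ Ux))).
Qed.

Section Fixed.
Context {n : nat} {U : set 'rV[R]_n}.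
Hypothesis oU : open U.

Lemma smooth_on_eq (W : normedModType R) (f g : 'rV[R]_n -> W) :
  (forall x, U x -> f x = g x) -> smooth_on U f -> smooth_on U g.
Proof.
by move=> fg /smooth_onP sf; apply/smooth_onP => k; exact: Ck_on_eq oU fg (sf k).
Qed.

Lemma smooth_on_cst (W : normedModType R) (a : W) : smooth_on U (fun=> a).
Proof. by apply/smooth_onP => k; exact: Ck_on_cst. Qed.

Lemma smooth_onM (f g : 'rV[R]_n -> R) :
  smooth_on U f -> smooth_on U g -> smooth_on U (fun x => f x * g x).
Proof.
by move=> /smooth_onP sf /smooth_onP sg; apply/smooth_onP => k; exact: Ck_onM.
Qed.

Lemma smooth_onD (f g : 'rV[R]_n -> R) :
  smooth_on U f -> smooth_on U g -> smooth_on U (fun x => f x + g x).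
Proof.
by move=> /smooth_onP sf /smooth_onP sg; apply/smooth_onP => k; exact: Ck_onD.
Qed.

Lemma smooth_on_sum (I : Type) (r : seq I) (P : pred I) (f : I -> 'rV[R]_n -> R) :
  (forall i, smooth_on U (f i)) ->
  smooth_on U (fun x => \sum_(i <- r | P i) f i x).
Proof.
move=> sf; apply/smooth_onP => k; apply: Ck_on_sum => // i _.
by have /smooth_onP := sf i; apply.
Qed.

Lemma smooth_on_prod (I : Type) (r : seq I) (P : pred I) (f : I -> 'rV[R]_n -> R) :
  (forall i, smooth_on U (f i)) ->
  smooth_on U (fun x => \prod_(i <- r | P i) f i x).
Proof.
move=> sf; elim: r => [|i r IH].
  by apply: smooth_on_eq _ (smooth_on_cst (1 : R)) => x _; rewrite big_nil.
have [Pi|/negbTE nPi] := boolP (P i).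
  by apply: smooth_on_eq _ (smooth_onM (sf i) IH) => x _; rewrite big_cons Pi.
by apply: smooth_on_eq _ IH => x _; rewrite big_cons nPi.
Qed.

Lemma smooth_on_mxP p q (f : 'rV[R]_n -> 'M[R]_(p, q)) :
  smooth_on U f <-> forall i j, smooth_on U (fun x => f x i j : R).
Proof.
split=> [/smooth_onP sf i j|sf].
  by apply/smooth_onP => k; apply: (Ck_on_mxP k f oU).1 (sf k) i j.
apply/smooth_onP => k; apply/(Ck_on_mxP k f oU) => i j.
by have /smooth_onP := sf i j; apply.
Qed.

Lemma smooth_on_mulmx p q r (f : 'rV[R]_n -> 'M[R]_(p, q))
    (g : 'rV[R]_n -> 'M[R]_(q, r)) :
  smooth_on U f -> smooth_on U g -> smooth_on U (fun x => f x *m g x).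
Proof.
move=> /smooth_on_mxP sf /smooth_on_mxP sg; apply/smooth_on_mxP => i j.
have : smooth_on U (fun x => \sum_k f x i k * g x k j).
  by apply: smooth_on_sum => k; apply: smooth_onM.
by apply: smooth_on_eq => x _; rewrite mxE.
Qed.

Lemma smooth_on_trmx p q (f : 'rV[R]_n -> 'M[R]_(p, q)) :
  smooth_on U f -> smooth_on U (fun x => (f x)^T).
Proof.
move=> /smooth_on_mxP sf; apply/smooth_on_mxP => i j.
by apply: smooth_on_eq _ (sf j i) => x _; rewrite mxE.
Qed.

Lemma smooth_on_col_mx p q r (f : 'rV[R]_n -> 'M[R]_(p, r))
    (g : 'rV[R]_n -> 'M[R]_(q, r)) :
  smooth_on U f -> smooth_on U g -> smooth_on U (fun x => col_mx (f x) (g x)).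
Proof.
move=> /smooth_on_mxP sf /smooth_on_mxP sg; apply/smooth_on_mxP => i j.
case: (splitP i) => k ik.
  have -> : i = lshift q k by exact: val_inj.
  by apply: smooth_on_eq _ (sf k j) => x _; rewrite col_mxEu.
have -> : i = rshift p k by exact: val_inj.
by apply: smooth_on_eq _ (sg k j) => x _; rewrite col_mxEd.
Qed.

Lemma smooth_on_det p (f : 'rV[R]_n -> 'M[R]_p) :
  smooth_on U f -> smooth_on U (fun x => \det (f x)).
Proof.
move=> /smooth_on_mxP sf; apply: smooth_on_sum => s.
apply: smooth_onM; first exact: smooth_on_cst.
exact: smooth_on_prod.
Qed.

Lemma smooth_on_adj p (f : 'rV[R]_n -> 'M[R]_p) :
  smooth_on U f -> smooth_on U (fun x => \adj (f x)).
Proof.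
move=> /smooth_on_mxP sf; apply/smooth_on_mxP => i j.
have : smooth_on U (fun x => (-1) ^+ (j + i) * \det (row' j (col' i (f x)))).
  apply: smooth_onM; first exact: smooth_on_cst.
  apply: smooth_on_det; apply/smooth_on_mxP => a b.
  by apply: smooth_on_eq _ (sf (lift j a) (lift i b)) => x _; rewrite !mxE.
by apply: smooth_on_eq => x _; rewrite mxE.
Qed.

Lemma smooth_on_jacobian p (f : 'rV[R]_n -> 'rV[R]_p) :
  smooth_on U f -> smooth_on U (fun x => 'J f x).
Proof.
move=> sf; apply/smooth_on_mxP => i j.
have : smooth_on U ('D_(delta_mx 0 i) f).
  by move=> vs x Ux; have := sf (rcons vs (delta_mx 0 i)) x Ux; rewrite foldr_rcons.
move=> /smooth_on_mxP/(_ 0 j); apply: smooth_on_eq => x Ux.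
by rewrite -(row_jacobian i (sf [::] x Ux)) mxE.
Qed.

Lemma smooth_on_comp p q r (V : set 'rV[R]_p)
    (f : 'rV[R]_n -> 'rV[R]_p) (h : 'rV[R]_p -> 'M[R]_(q, r)) :
  open V -> (forall x, U x -> V (f x)) -> smooth_on U f -> smooth_on V h ->
  smooth_on U (h \o f).
Proof.
move=> oV UV /smooth_onP sf /smooth_onP sh; apply/smooth_on_mxP => i j.
apply/smooth_onP => k.
exact: Ck_on_comp oU UV (sf k) ((Ck_on_mxP k h oV).1 (sh k) i j).
Qed.

End Fixed.

Lemma smooth_on_sub n (W : normedModType R) (U V : set 'rV[R]_n) (f : 'rV[R]_n -> W) :
  U `<=` V -> smooth_on V f -> smooth_on U f.
Proof. by move=> UV sf vs x /UV; exact: sf. Qed.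

End SmoothOperations.

(** * Orthogonality for an inner product *)

Section InnerProduct.
Context {R : realType} {N : nat} {g : 'M[R]_N}.
Hypothesis g_sym : g^T = g.
Hypothesis g_pos : forall v : 'rV[R]_N, v != 0 -> 0 < (v *m g *m v^T) 0 0.

Local Notation orth W := (kermx (g *m W^T)).

Lemma sub_orthE a b (V : 'M[R]_(a, N)) (W : 'M[R]_(b, N)) :
  (V <= orth W)%MS = (V *m g *m W^T == 0).
Proof. by rewrite sub_kermx mulmxA. Qed.

Lemma sub_orthC a b (V : 'M[R]_(a, N)) (W : 'M[R]_(b, N)) :
  (V <= orth W)%MS = (W <= orth V)%MS.
Proof.
by rewrite !sub_orthE -(inj_eq trmx_inj) !trmx_mul trmx0 trmxK g_sym mulmxA.
Qed.

Lemma orthS a b (V : 'M[R]_(a, N)) (W : 'M[R]_(b, N)) :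
  (V <= W)%MS -> (orth W <= orth V)%MS.
Proof. by move=> VW; rewrite sub_orthC (submx_trans VW)// sub_orthC. Qed.

Lemma sub_orth_add a b c (V : 'M[R]_(a, N)) (W : 'M[R]_(b, N)) (Z : 'M[R]_(c, N)) :
  (V <= orth (W + Z)%MS)%MS = (V <= orth W)%MS && (V <= orth Z)%MS.
Proof. by rewrite !(sub_orthC V) addsmx_sub. Qed.

Lemma self_orth0 (v : 'rV[R]_N) : (v <= orth v)%MS -> v = 0.
Proof.
rewrite sub_orthE => /eqP v0; apply/eqP/negPn/negP => /g_pos.
by rewrite v0 mxE ltxx.
Qed.

Lemma cap_orth0 a b (V : 'M[R]_(a, N)) (W : 'M[R]_(b, N)) :
  (V <= orth W)%MS -> (V :&: W)%MS = 0.
Proof.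
move=> VW; apply/eqP; rewrite -submx0; apply/rV_subP => v.
rewrite sub_capmx => /andP[vV vW].
suff -> : v = 0 by exact: sub0mx.
by apply: self_orth0; exact: submx_trans (submx_trans vV VW) (orthS vW).
Qed.

(** If u kills the Gram matrix, the combination u *m S lies in T and is orthogonal
    to T, hence to itself. *)
Lemma row_free_gram a b (S : 'M[R]_(a, N)) (T : 'M[R]_(b, N)) :
  row_free S -> (S <= T)%MS -> row_free (S *m g *m T^T).
Proof.
move=> Sf ST; rewrite -kermx_eq0 -submx0; apply/rV_subP => u.
rewrite sub_kermx !mulmxA -!sub_orthE => uS; rewrite submx0.
rewrite -(mulmx_free_eq0 _ Sf); apply/eqP/self_orth0.
by rewrite (submx_trans uS)// orthS// (submx_trans (submxMl _ _)).
Qed.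

(** W meets its orthogonal complement trivially, and the complement is cut out by
    rank W equations, so the two have complementary dimensions. *)
Lemma sub_add_orth a b (V : 'M[R]_(a, N)) (W : 'M[R]_(b, N)) :
  (V <= W + orth W)%MS.
Proof.
apply: submx_full; rewrite /row_full eqn_leq rank_leq_col /=.
have : mxdirect (W + orth W).
  by apply/mxdirect_addsP; rewrite capmxC cap_orth0.
rewrite mxdirectE /= => /eqP ->; rewrite mxrank_ker.
have le : (\rank (g *m W^T) <= \rank W)%N.
  by rewrite -mxrank_tr trmx_mul trmxK mxrankM_maxl.
by rewrite -leq_subLR leq_sub2l.
Qed.

(** Intersecting the splitting of the whole space with T, by the modular law. *)
Lemma orth_split a b (W : 'M[R]_(a, N)) (T : 'M[R]_(b, N)) :
  (W <= T)%MS -> (T <= W + (T :&: orth W))%MS.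
Proof.
move=> WT; rewrite capmxC (matrix_modl _ WT) sub_capmx submx_refl andbT.
exact: sub_add_orth.
Qed.
End InnerProduct.

(** * Kernels of smooth matrices of constant rank *)

Section KernelFrame.
Context {R : realType}.

Lemma smooth_on_continuous n (W : normedModType R) (U : set 'rV[R]_n)
    (f : 'rV[R]_n -> W) x :
  smooth_on U f -> U x -> {for x, continuous f}.
Proof. by move=> sf Ux; apply: differentiable_continuous; exact: (sf [::]). Qed.

(** Near x0, let L be a left inverse of B x0 and let the rows of P be a basis of
    its kernel. Up to the factor det (L B), the matrix 1 - B (L B)^-1 L projects
    onto the kernel of B; replacing the inverse by the adjugate keeps the formula
    polynomial in B and makes K B = 0 hold even where L B is singular. At x0 the
    rows of K are those of P, and staying independent is an open
    condition, after which the rank of B forces K to span the kernel. *)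
Lemma smooth_kernel_frame n a r (U : set 'rV[R]_n) (B : 'rV[R]_n -> 'M[R]_(a, r))
    (x0 : 'rV[R]_n) : open U -> U x0 -> smooth_on U B ->
  (forall x, U x -> \rank (B x) = r) ->
  exists (V : set 'rV[R]_n) (K : 'rV[R]_n -> 'M[R]_(a - r, a)),
    [/\ open V, V x0, V `<=` U, smooth_on V K &
        forall x, V x -> row_free (K x) /\ (K x :=: kermx (B x))%MS].
Proof.
move=> oU Ux0 sB rkB.
have [P [Pfree PB]] : exists P : 'M[R]_(a - r, a), row_free P /\ P *m B x0 = 0.
  rewrite -[r in (a - r)%N](rkB x0 Ux0) -mxrank_ker.
  exists (row_base (kermx (B x0))); split; first exact: row_base_free.
  by apply/eqP; rewrite -sub_kermx eq_row_base.
pose L := pinvmx (B x0).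
have LB : L *m B x0 = 1%:M by rewrite mulVpmx// /row_full rkB.
pose K x := P *m ((\det (L *m B x))%:M - B x *m \adj (L *m B x) *m L).
have KB x : K x *m B x = 0.
  rewrite /K -mulmxA mulmxBl -[_ *m L *m B x]mulmxA -[_ *m (L *m B x)]mulmxA.
  by rewrite mul_adj_mx mul_scalar_mx mul_mx_scalar subrr mulmx0.
have sK : smooth_on U K.
  have sLB : smooth_on U (fun x => L *m B x).
    by apply: smooth_on_mulmx => //; exact: smooth_on_cst.
  apply: smooth_on_mulmx => //; first exact: smooth_on_cst.
  have sBL : smooth_on U (fun x => B x *m \adj (L *m B x) *m L).
    apply: smooth_on_mulmx => //; last exact: smooth_on_cst.
    by apply: smooth_on_mulmx => //; exact: smooth_on_adj.
  apply/smooth_on_mxP => // i j.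
  have : smooth_on U (fun x => \det (L *m B x) * (1%:M : 'M[R]_a) i j +
      -1 * (B x *m \adj (L *m B x) *m L) i j).
    apply: smooth_onD => //; apply: smooth_onM => //; do ?exact: smooth_on_cst.
      exact: smooth_on_det.
    exact: (smooth_on_mxP oU _).1 sBL i j.
  by apply: smooth_on_eq => // x _; rewrite !mxE mulN1r mulr_natr.
have Kx0 : K x0 *m pinvmx P = 1%:M.
  rewrite /K LB det1 adj1 mulmx1 mulmxBr [P *m (_ *m _)]mulmxA PB mul0mx subr0 mulmx1.
  by rewrite mulmxVp.
(* the rows of K x are independent wherever this determinant is nonzero *)
pose d x := \det (K x *m pinvmx P).
have sd : smooth_on U d.
  by apply: smooth_on_det => //; apply: smooth_on_mulmx => //; exact: smooth_on_cst.
pose V := U `&` [set x | d x != 0].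
have oV : open V.
  rewrite openE => x [Ux dx]; apply: filterI; first exact: open_nbhs_nbhs.
  have cd : d y @[y --> x] --> d x by exact: smooth_on_continuous sd Ux.
  exact: cvgr_neq0 cd dx.
exists V, K; split => //.
- by split => //=; rewrite /d Kx0 det1 oner_eq0.
- by move=> x [].
- by apply: smooth_on_sub sK => x [].
move=> x [Ux dx]; have Kfree : row_free (K x).
  have : K x *m pinvmx P \in unitmx by rewrite unitmxE unitfE.
  move=> /mulmxV KP; apply/row_freeP.
  by exists (pinvmx P *m invmx (K x *m pinvmx P)); rewrite mulmxA.
split=> //; apply/eqmxP; rewrite -(geq_leqif (mxrank_leqif_eq _)).
  by rewrite mxrank_ker (rkB x Ux) (eqP Kfree).
by apply/sub_kermxP.
Qed.

End KernelFrame.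

(** * Tangent vectors in charts *)

Section Charts.
Context {R : realType} {n : nat}.
Implicit Types M : smooth_manifold R n.

(** Inside the open set [chart i @` chart_dom i] this image is the preimage of O by
    the continuous inverse chart. *)
Lemma chart_img_openI M (i : chart_index M) (O : set M) :
  open O -> open (chart i @` (O `&` chart_dom i)).
Proof.
move=> oO; rewrite openE => _ [p [Op ip] <-].
have ipi : (chart i @` chart_dom i) (chart i p) by exists p.
have nbi : nbhs (chart i p) (chart i @` chart_dom i).
  by apply: open_nbhs_nbhs; split=> //; exact: chart_img_open.
have nbO : nbhs (chart i p) (chart_inv i @^-1` O).
  have := chart_inv_continuous ipi; apply.
  by apply: open_nbhs_nbhs; rewrite chartK.
apply: filterS (filterI nbi nbO) => _ [[q iq <-] /=].
by rewrite chartK // => Oq; exists q.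
Qed.

Lemma chart_preimg_open M (i : chart_index M) (V : set 'rV[R]_n) :
  open V -> open (chart_dom i `&` chart i @^-1` V).
Proof.
move=> oV; rewrite openE => p [ip Vp]; apply: filterI.
  by apply: open_nbhs_nbhs; split=> //; exact: chart_dom_open.
by apply: (chart_continuous ip); exact: open_nbhs_nbhs.
Qed.

Lemma smooth_fun_on_chart M (i : chart_index M) (O : set M) p q
    (V : set 'rV[R]_n) (h : 'rV[R]_n -> 'M[R]_(p, q)) :
  open O -> open V -> (forall x, O x -> chart_dom i x /\ V (chart i x)) ->
  smooth_on V h -> smooth_fun_on O (h \o chart i).
Proof.
move=> oO oV OV sh l.
have oU := chart_img_openI (i := l) oO.
have -> : (h \o chart i) \o chart_inv l = h \o (chart i \o chart_inv l) by [].
apply: (smooth_on_comp oU oV _ _ sh).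
  by move=> _ [x [Ox lx] <-] /=; rewrite chartK//; have [] := OV x Ox.
apply: smooth_on_sub _ (@chart_transition _ _ M l i) => _ [x [Ox lx] <-].
by exists x => //; split=> //; have [] := OV x Ox.
Qed.

Lemma jacobian_id p (x : 'rV[R]_p) (f : 'rV[R]_p -> 'rV[R]_p) :
  (\near x, f x = x) -> 'J f x = 1%:M.
Proof.
move=> fid; have did : differentiable (@idfun 'rV[R]_p) x.
  by have := @ex_diff _ _ _ _ _ _ _ (is_diff_id x).
have idf : \near x, idfun x = f x by apply: filterS fid => y ->.
rewrite -(jacobian_near_eq idf did); apply/row_matrixP => i.
by rewrite (row_jacobian i did) derive_id row1.
Qed.

End Charts.

Section ChartMaps.
Context {R : realType} {n k : nat}.
Variables (M : smooth_manifold R n) (N : smooth_manifold R k) (f : M -> N).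
Hypothesis sf : smooth_map f.

(** Near the point, the coordinate expression of f factors through the charts that
    serve to represent tangent vectors; the chain rule gives the three factors. *)
Lemma jacobian_charts (i : chart_index M) (j : chart_index N) q :
  chart_dom i q -> chart_dom j (f q) ->
  'J (chart j \o f \o chart_inv i) (chart i q) =
    chart_frame i q *m tangent_map f q *m to_chart j (f q).
Proof.
move=> iq jq; have [cf sfij] := sf.
set c := chart_at q; set d := chart_at (f q).
have cq : chart_dom c q by exact: chart_atP.
have dq : chart_dom d (f q) by exact: chart_atP.
pose F1 := chart c \o chart_inv i; pose F2 := chart d \o f \o chart_inv c.
pose F3 := chart j \o chart_inv d.
have F1q : F1 (chart i q) = chart c q by rewrite /F1 /= chartK.
have F2q : F2 (chart c q) = chart d (f q) by rewrite /F2 /= chartK.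
have dF1 : differentiable F1 (chart i q).
  by apply: (@chart_transition _ _ _ i c [::]); exists q.
have dF2 : differentiable F2 (F1 (chart i q)).
  by rewrite F1q; apply: (@sfij c d [::]); exists q.
have dF3 : differentiable F3 (F2 (F1 (chart i q))).
  by rewrite F1q F2q; apply: (@chart_transition _ _ _ d j [::]); exists (f q).
have dF32 : differentiable (F3 \o F2) (F1 (chart i q)) by exact: differentiable_comp.
have dF : differentiable ((F3 \o F2) \o F1) (chart i q).
  exact: (differentiable_comp dF1 dF32).
have FE : \forall x \near chart i q,
    ((F3 \o F2) \o F1) x = (chart j \o f \o chart_inv i) x.
  have oO : open (f @^-1` chart_dom d `&` chart_dom c).
    apply: openI; last exact: chart_dom_open.
    by apply: open_comp => [x _|]; [exact: cf | exact: chart_dom_open].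
  have := chart_img_openI (i := i) oO; rewrite openE => /(_ (chart i q)).
  have iq' : (chart i @` ((f @^-1` chart_dom d `&` chart_dom c) `&` chart_dom i))
      (chart i q).
    by exists q.
  move=> /(_ iq'); apply: filterS => _ [y [[dy cy] iy] <-].
  by rewrite /F1 /F2 /F3 /= !chartK.
rewrite -(jacobian_near_eq FE dF) (jacobian_comp dF1 dF32) (jacobian_comp dF2 dF3).
by rewrite F1q F2q mulmxA.
Qed.

End ChartMaps.

Section Frames.
Context {R : realType} {n : nat} {M : smooth_manifold R n}.

(** The previous formula for the identity map, whose tangent map is the identity
    matrix. *)
Lemma jacobian_transition (i l : chart_index M) q :
  chart_dom i q -> chart_dom l q ->
  'J (chart l \o chart_inv i) (chart i q) = chart_frame i q *m to_chart l q.
Proof.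
move=> iq lq; have sid : smooth_map (@idfun M).
  by split=> [x|i' j']; [exact: cvg_id | exact: chart_transition].
have -> : chart l \o chart_inv i = chart l \o @idfun M \o chart_inv i by [].
rewrite (jacobian_charts sid iq lq) [tangent_map _ _]jacobian_id ?mulmx1//.
have := chart_img_open (i := chart_at q); rewrite openE => /(_ (chart (chart_at q) q)).
have qd : (chart (chart_at q) @` chart_dom (chart_at q)) (chart (chart_at q) q).
  by exists q => //; exact: chart_atP.
by move=> /(_ qd); apply: filterS => _ [y yd <-] /=; rewrite chartK.
Qed.

Lemma chart_frameK (i : chart_index M) q :
  chart_dom i q -> chart_frame i q *m to_chart i q = 1%:M.
Proof.
move=> iq; rewrite -jacobian_transition// jacobian_id//.
have := chart_img_open (i := i); rewrite openE => /(_ (chart i q)).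
have qd : (chart i @` chart_dom i) (chart i q) by exists q.
by move=> /(_ qd); apply: filterS => _ [y yd <-] /=; rewrite chartK.
Qed.

Lemma to_chartK (i : chart_index M) q :
  chart_dom i q -> to_chart i q *m chart_frame i q = 1%:M.
Proof. by move=> /chart_frameK/mulmx1C. Qed.

(** In another chart l the components of the field are those in the chart i
    multiplied by the Jacobian of the transition map, which is smooth. *)
Lemma smooth_vf_on_chart (i : chart_index M) (O : set M) (V : set 'rV[R]_n)
    (h : 'rV[R]_n -> 'rV[R]_n) :
  open O -> open V -> (forall x, O x -> chart_dom i x /\ V (chart i x)) ->
  smooth_on V h -> smooth_vf_on O (fun q => h (chart i q) *m chart_frame i q).
Proof.
move=> oO oV OV sh l.
pose W := V `&` (chart i @` (chart_dom l `&` chart_dom i)).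
have oW : open W by apply: openI => //; apply: chart_img_openI; exact: chart_dom_open.
have oOl : open (O `&` chart_dom l) by apply: openI => //; exact: chart_dom_open.
have sH : smooth_on W (fun x => h x *m 'J (chart l \o chart_inv i) x).
  apply: smooth_on_mulmx => //; first by apply: smooth_on_sub _ sh => x [].
  apply: smooth_on_jacobian => //; apply: smooth_on_sub _ (@chart_transition _ _ M i l).
  by move=> _ [_ [x [lx ix] <-]]; exists x.
have OW x : (O `&` chart_dom l) x -> chart_dom i x /\ W (chart i x).
  by move=> [/OV[ix Vx] lx]; split=> //; split=> //; exists x.
have := smooth_fun_on_chart oOl oW OW sH => + l' => /(_ l').
apply: smooth_on_eq; first exact: chart_img_openI.
move=> _ [x [[Ox lx] l'x] <-]; have [ix _] := OV x Ox.
rewrite /comp (chartK l'x).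
rewrite (jacobian_transition ix lx).
by rewrite mulmxA.
Qed.

End Frames.

(** * Smoothness of the ambiguous distribution *)

(** Invariance of the Gram matrix under a change of frame of the ambient space: T
    and S are multiplied by P, the metric by its inverse Q on both sides. *)
Lemma gram_change_basis (R : comPzRingType) a b c d (A : 'M[R]_(a, b)) (T : 'M[R]_(b, d))
    (S : 'M[R]_(c, d)) (g P Q : 'M[R]_d) : P *m Q = 1%:M ->
  A *m T *m P *m (Q *m g *m Q^T) *m (S *m P)^T = A *m (T *m g *m S^T).
Proof.
move=> PQ; rewrite trmx_mul !mulmxA -(mulmxA _ P) PQ mulmx1.
by rewrite -(mulmxA _ Q^T) -trmx_mul PQ trmx1 mulmx1.
Qed.

Section SasakianAlgebra.
Context {R : realType} {m : nat} (Mbar : sasakian_manifold R m).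
Local Notation N := ((2 * m).+1).

Lemma ev2_delta (A : 'M[R]_N) i j :
  ((delta_mx 0 i : 'rV[R]_N) *m A *m (delta_mx 0 j : 'rV[R]_N)^T) 0 0 = A i j.
Proof. by rewrite -rowE trmx_delta -colE !mxE. Qed.

Lemma sas_g_sym (p : Mbar) : (sas_g p)^T = sas_g p.
Proof.
have [_ sym _] := sas_metric Mbar; apply/matrixP => i j; rewrite mxE.
by rewrite -!ev2_delta; exact: sym.
Qed.

Lemma sas_g_pos (p : Mbar) (v : 'rV[R]_N) : v != 0 -> 0 < (v *m sas_g p *m v^T) 0 0.
Proof. by have [_ _ pos] := sas_metric Mbar; exact: pos. Qed.

(** Compatibility of g with phi, applied to xi: the left-hand side vanishes because
    phi xi = 0. *)
Lemma sas_eta_metric (p : Mbar) : sas_eta p = sas_g p *m (sas_xi p)^T.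
Proof.
apply/row_matrixP => i; rewrite !rowE mulmxA; apply/rowP => k; rewrite [k]ord1.
have := sas_compat p (delta_mx 0 i) (sas_xi p).
rewrite sas_phi_xi sas_eta_xi mulr1 /ev2 trmx0 mulmx0 mxE.
by move/esym/eqP; rewrite subr_eq0 => /eqP.
Qed.

Lemma sas_xi_neq0 (p : Mbar) : sas_xi p != 0.
Proof.
apply/eqP => xi0; have := sas_eta_xi p.
by rewrite /ev1 xi0 mul0mx mxE => /esym/eqP; rewrite oner_eq0.
Qed.

End SasakianAlgebra.

Section Distributions.
Context {R : realType} {m n : nat} {Mbar : sasakian_manifold R m}.
Context {M : immersed_submanifold n Mbar}.
Local Notation N := ((2 * m).+1).
Local Notation incl := (@sub_incl _ _ _ _ M).
Implicit Types D E : M -> 'M[R]_N.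

Lemma metric_sym (p : M) : (sas_g (incl p))^T = sas_g (incl p).
Proof. exact: sas_g_sym. Qed.

Lemma metric_pos (p : M) (v : 'rV[R]_N) :
  v != 0 -> 0 < (v *m sas_g (incl p) *m v^T) 0 0.
Proof. exact: sas_g_pos. Qed.

Lemma smooth_distribution_eqmx D E :
  (forall p, (D p :=: E p)%MS) -> smooth_distribution D -> smooth_distribution E.
Proof.
move=> DE [r Dr]; exists r => p; have [W [X [oO Op sX HX]]] := Dr p.
exists W, X; split=> // q /HX[rk DX]; split; first by rewrite -(DE q).
exact: eqmx_trans (eqmx_sym (DE q)) DX.
Qed.

Lemma contact_partE (p : M) : contact_part p = (TM p :&: orth p (xi_at p))%MS.
Proof. by rewrite /contact_part sas_eta_metric. Qed.

(** In charts i of M around p0 and j of the ambient manifold, let T be the Jacobian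
    of the immersion, G the metric, and let the rows of S be a local frame of E
    followed by xi. A vector with components u in the chart i lies in the
    ambiguous distribution iff u T G S^T = 0. The frame S is independent, since E
    is orthogonal to xi, and lies in TM, so this Gram matrix has full rank r + 1
    and [smooth_kernel_frame] applies. *)
Lemma ambiguous_smooth E : reeb_tangent M -> smooth_distribution E ->
  (forall p, (E p <= contact_part p)%MS) -> smooth_distribution (ambiguous E).
Proof.
move=> hxi [r Er] Ec; exists (n - (r + 1))%N => p0.
have [ O [X [oO Op0 sX EX]]] := Er p0.
set i := chart_at p0; set j := chart_at (incl p0).
have [cf sf] := sub_smooth M.
pose O1 := (O `&` incl @^-1` chart_dom j) `&` chart_dom i.
have oOj : open (O `&` incl @^-1` chart_dom j).
  apply: openI => //; apply: open_comp => [x _|]; [exact: cf | exact: chart_dom_open].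
have oO1 : open O1 by apply: openI => //; exact: chart_dom_open.
pose U := chart i @` O1.
have oU : open U by exact: chart_img_openI.
have O1p0 : O1 p0 by split; [split=> //|]; exact: chart_atP.
(* the immersion in coordinates; below, the metric, xi and the frame X are
   written in the coordinates j, j and i *)
pose F := chart j \o incl \o chart_inv i.
have UE x : U x -> exists q, [/\ O q, chart_dom i q, chart_dom j (incl q),
    chart i q = x & chart_inv i x = q].
  by move=> [q [[Oq jq] iq] <-]; exists q; rewrite chartK.
have sF : smooth_on U F.
  by apply: smooth_on_sub _ (@sf i j) => _ [q [[Oq jq] iq] <-]; exists q.
have UF x : U x -> (chart j @` chart_dom j) (F x).
  by move=> /UE[q [Oq iq jq _ qx]]; exists (incl q); rewrite // /F /= qx.
have ojj := chart_img_open (i := j).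
pose T x := 'J F x.
have sT : smooth_on U T by exact: smooth_on_jacobian.
pose G x := chart_frame j (chart_inv j x) *m sas_g (chart_inv j x) *m
  (chart_frame j (chart_inv j x))^T.
have sG : smooth_on U (G \o F).
  apply: (smooth_on_comp oU ojj UF sF).
  have [sg _ _] := sas_metric Mbar.
  by apply: smooth_on_sub _ (sg j j) => _ [q jq <-]; exists q.
pose xi x := sas_xi (chart_inv j x) *m to_chart j (chart_inv j x).
have sxi : smooth_on U (xi \o F).
  apply: (smooth_on_comp oU ojj UF sF).
  by apply: smooth_on_sub _ (@sas_xi_smooth _ _ Mbar j j) => _ [q jq <-]; exists q.
pose Y x := X (chart_inv i x) *m to_chart i (chart_inv i x).
have sY : smooth_on U Y.
  apply/(smooth_on_mxP oU) => k l.
  have := sX k i i; move=> /(smooth_on_sub _) sXk.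
  have : smooth_on U (fun x => row k (X (chart_inv i x)) *m to_chart i (chart_inv i x)).
    by apply: sXk => _ [q [[Oq jq] iq] <-]; exists q.
  move=> /(smooth_on_mxP oU)/(_ 0 l); apply: smooth_on_eq => // x _.
  by rewrite /Y -row_mul mxE.
pose S x := col_mx (Y x *m T x) (xi (F x)).
have sS : smooth_on U S.
  by apply: smooth_on_col_mx => //; apply: smooth_on_mulmx.
pose B x := T x *m G (F x) *m (S x)^T.
have sB : smooth_on U B.
  apply: smooth_on_mulmx => //; last exact: smooth_on_trmx.
  exact: smooth_on_mulmx.
pose Sq q := col_mx (X q *m TM q) (xi_at q).
have BE q : O1 q ->
    B (chart i q) = chart_frame i q *m (TM q *m sas_g (incl q) *m (Sq q)^T).
  move=> [[Oq jq] iq].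
  have TE : T (chart i q) = chart_frame i q *m TM q *m to_chart j (incl q).
    exact: (jacobian_charts (sub_smooth M)).
  have SE : S (chart i q) = Sq q *m to_chart j (incl q).
    rewrite /S TE /Y /F /xi /= !chartK// mul_col_mx; congr col_mx.
    by rewrite !mulmxA -(mulmxA (X q)) to_chartK// mulmx1.
  have GE : G (F (chart i q)) = chart_frame j (incl q) *m sas_g (incl q) *m
      (chart_frame j (incl q))^T by rewrite /G /F /= !chartK.
  rewrite /B SE TE GE.
  exact: gram_change_basis (to_chartK jq).
have SqE q : O1 q -> (Sq q :=: E q + xi_at q)%MS /\ row_free (Sq q).
  move=> [[Oq jq] iq]; have [rk EXq] := EX q Oq.
  have SE : (Sq q :=: E q + xi_at q)%MS.
    apply: eqmx_trans (eqmx_sym (addsmxE _ _)) _.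
    exact: adds_eqmx (eqmx_sym EXq) (eqmx_refl _).
  split=> //; rewrite /row_free SE.
  have : mxdirect (E q + xi_at q).
    apply/mxdirect_addsP; apply: (cap_orth0 (metric_sym q) (@metric_pos q)).
    by have := Ec q; rewrite contact_partE sub_capmx => /andP[].
  by rewrite mxdirectE /= => /eqP ->; rewrite rk rank_rV sas_xi_neq0.
have unit_frame q : O1 q -> chart_frame i q \in unitmx.
  move=> [_ iq]; exact: (mulmx1_unit (chart_frameK iq)).1.
have ST q : O1 q -> (Sq q <= TM q)%MS.
  move=> Oq; have [-> _] := SqE q Oq; rewrite addsmx_sub hxi andbT.
  by rewrite (submx_trans (Ec q))// capmxSl.
have rkB x : U x -> \rank (B x) = (r + 1)%N.
  move=> [q Oq <-]; rewrite (BE q Oq).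
  rewrite (eqmxMfull _ _) ?row_full_unit ?unit_frame// -mxrank_tr.
  rewrite !trmx_mul trmxK (metric_sym q) mulmxA.
  exact: (eqP (row_free_gram (metric_sym q) (@metric_pos q) (SqE q Oq).2 (ST q Oq))).
have Ux0 : U (chart i p0) by exists p0.
have [V [K [oV Vx0 VU sK KE]]] := smooth_kernel_frame oU Ux0 sB rkB.
pose O2 := O1 `&` (chart_dom i `&` chart i @^-1` V).
have oO2 : open O2 by apply: openI => //; exact: chart_preimg_open.
exists O2, (fun q => K (chart i q) *m chart_frame i q); split => //.
- by split => //; split=> //; exact: chart_atP.
- move=> k; have sKk : smooth_on V (fun x => row k (K x)).
    apply/(smooth_on_mxP oV) => a b.
    have := (smooth_on_mxP oV _).1 sK k b.
    by apply: smooth_on_eq => // x _; rewrite mxE.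
  have := smooth_vf_on_chart oO2 oV (fun x Ox => Ox.2) sKk.
  by congr smooth_vf_on; apply/funext => q; rewrite row_mul.
move=> q [Oq [iq Vq]]; have [Kfree KerE] := KE _ Vq.
have frame_free : row_free (chart_frame i q) by rewrite row_free_unit unit_frame.
have [SE _] := SqE q Oq.
have KTM : (ambiguous E q :=: K (chart i q) *m chart_frame i q *m TM q)%MS.
  apply/eqmxP/andP; split.
    apply/rV_subP => v; rewrite sub_capmx => /andP[/submxP[u ->] uS].
    have uK : (u *m to_chart i q <= K (chart i q))%MS.
      rewrite KerE sub_kermx (BE q Oq) !mulmxA -(mulmxA u) to_chartK// mulmx1.
      by rewrite -sub_orthE (submx_trans uS)// (orthS (metric_sym q))// SE.
    rewrite submxMr// -[u](mulmx1) -(to_chartK iq) mulmxA.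
    exact: submxMr.
  rewrite sub_capmx submxMl /=.
  rewrite /orth (submx_trans _ (orthS (metric_sym q) (_ : (_ <= Sq q)%MS)))//;
    last by rewrite SE.
  rewrite sub_orthE -!mulmxA; apply/eqP.
  have KB : K (chart i q) *m B (chart i q) = 0 by apply/sub_kermxP; rewrite KerE.
  by rewrite (BE q Oq) -!mulmxA in KB.
split => //; rewrite KTM mxrankMfree; last exact: sub_immersion.
by rewrite mxrankMfree //; apply/eqP.
Qed.

End Distributions.

(** * Orthogonal decompositions *)

Section AmbiguousDistribution.
Context {R : realType} {m n : nat} {Mbar : sasakian_manifold R m}.
Context {M : immersed_submanifold n Mbar}.
Local Notation N := ((2 * m).+1).
Implicit Types D E : M -> 'M[R]_N.

Lemma totally_realS D E :
  (forall p, (D p <= E p)%MS) -> totally_real E -> totally_real D.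
Proof. by move=> DE rE p; apply: submx_trans (rE p); exact: submxMr. Qed.

Lemma sub_ambiguous D p k (V : 'M[R]_(k, N)) :
  (V <= ambiguous D p)%MS =
    [&& (V <= TM p)%MS, (V <= orth p (D p))%MS & (V <= orth p (xi_at p))%MS].
Proof. by rewrite sub_capmx (sub_orth_add (metric_sym p)). Qed.

Lemma sub_contact p k (V : 'M[R]_(k, N)) :
  (V <= contact_part p)%MS = (V <= TM p)%MS && (V <= orth p (@xi_at _ _ _ _ M p))%MS.
Proof. by rewrite contact_partE sub_capmx. Qed.

Lemma ambiguous_contact D p : (ambiguous D p <= contact_part p)%MS.
Proof.
have := submx_refl (ambiguous D p).
by rewrite sub_ambiguous sub_contact => /and3P[-> _ ->].
Qed.

(** The orthogonal complement of D inside TM \cap ker eta is contained in the ambiguous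
    distribution, as ker eta is the orthogonal complement of xi. *)
Lemma contact_split D p : (D p <= contact_part p)%MS ->
  (contact_part p <= D p + ambiguous D p)%MS.
Proof.
move=> Dc; apply: submx_trans (orth_split (metric_sym p) (@metric_pos _ _ _ _ _ p) Dc) _.
apply: addsmxS => //; rewrite sub_ambiguous capmxSr /=.
by rewrite -sub_contact capmxSl.
Qed.

Lemma TM_split D p : (xi_at p <= TM p)%MS -> (D p <= contact_part p)%MS ->
  (TM p :=: D p + ambiguous D p + <<xi_at p>>)%MS.
Proof.
move=> xiT; rewrite sub_contact => /andP[DT _]; apply/eqmxP/andP; split.
  have WT : (D p + xi_at p <= TM p)%MS by rewrite addsmx_sub DT.
  apply: submx_trans (orth_split (metric_sym p) (@metric_pos _ _ _ _ _ p) WT) _.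
  rewrite -[(TM p :&: _)%MS]/(ambiguous D p) -addsmxA (addsmxC (xi_at p)) addsmxA.
  by rewrite addsmxS// genmxE.
by rewrite !addsmx_sub DT genmxE xiT capmxSl.
Qed.

Lemma smooth_distribution0 : smooth_distribution (fun _ : M => 0 : 'M[R]_N).
Proof.
exists 0 => p; exists setT, (fun=> 0); split=> //; first exact: openT.
  by case.
move=> q _; rewrite mxrank0 mul0mx; split=> //.
by apply/eqmxP; rewrite !sub0mx.
Qed.

(** TM \cap ker eta is the ambiguous distribution of the zero distribution. *)
Lemma contact_part_smooth : reeb_tangent M -> smooth_distribution (contact_part (M := M)).
Proof.
move=> hxi; apply: (@smooth_distribution_eqmx _ _ _ _ _ (ambiguous (fun=> 0))).
  move=> p; apply/eqmxP; rewrite ambiguous_contact /= .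
  have := @contact_split (fun=> 0) p (sub0mx _ _); rewrite adds0mx; exact.
by apply: ambiguous_smooth => //; [exact: smooth_distribution0 | move=> p; exact: sub0mx].
Qed.

(** Orthogonality gives E <= ambiguous D. By the modular law the ambiguous
    distribution is E plus its part in D + <xi>, to which it is orthogonal, so
    that part is zero. *)
Lemma orth_decomposition_ambiguous D E :
  orth_decomposition D E ->
  forall p, (D p <= contact_part p)%MS /\ (E p :=: ambiguous D p)%MS.
Proof.
move=> [_ [_ dec]] p; have [TE _ DE Dxi Exi] := dec p.
have /andP[/andP[DT ET] xiT] :
    [&& (D p <= TM p)%MS && (E p <= TM p)%MS & (<<xi_at p>> <= TM p)%MS].
  by rewrite -!addsmx_sub TE.
split; first by rewrite sub_contact DT.
have EA : (E p <= ambiguous D p)%MS.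
  by rewrite sub_ambiguous ET (sub_orthC (metric_sym p)) DE.
apply/eqmxP; rewrite EA /=.
have DA : ((D p + xi_at p) :&: ambiguous D p)%MS = 0.
  by rewrite capmxC (cap_orth0 (metric_sym p) (@metric_pos _ _ _ _ _ p)) ?capmxSr.
have : (ambiguous D p <= (E p + (D p + xi_at p)) :&: ambiguous D p)%MS.
  rewrite sub_capmx submx_refl andbT (submx_trans (capmxSl _ _))// TE.
  rewrite !addsmx_sub addsmxSl genmxE.
  by rewrite !(submx_trans _ (addsmxSr _ (D p + xi_at p)%MS)) ?addsmxSl ?addsmxSr.
by rewrite -(matrix_modl _ EA) DA addsmx0.
Qed.

Lemma ambiguous_orth_decomposition D E : reeb_tangent M ->
  smooth_distribution D -> (forall p, (D p <= contact_part p)%MS) ->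
  (forall p, (E p :=: ambiguous D p)%MS) -> orth_decomposition D E.
Proof.
move=> hxi sD Dc EA; split=> //; split.
  apply: smooth_distribution_eqmx (fun p => eqmx_sym (EA p)) _.
  exact: ambiguous_smooth.
move=> p; have := submx_refl (ambiguous D p).
rewrite -{1}EA sub_ambiguous => /and3P[_ ED Exi].
have := Dc p; rewrite sub_contact => /andP[_ Dxi].
have DE : (D p <= orth p (E p))%MS by rewrite (sub_orthC (metric_sym p)).
split=> //.
  apply: eqmx_trans (TM_split (hxi p) (Dc p)) _.
  by apply: adds_eqmx => //; apply: adds_eqmx => //; exact: eqmx_sym.
rewrite mxdirect_addsE /= mxdirect_addsE /= !mxdirect_trivial /=.
rewrite (cap_orth0 (metric_sym p) (@metric_pos _ _ _ _ _ p) DE) eqxx /=.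
rewrite (cap_orth0 (metric_sym p) (@metric_pos _ _ _ _ _ p)) //.
rewrite (sub_orthC (metric_sym p)) (sub_orth_add (metric_sym p)).
by rewrite !genmxE !(sub_orthC (metric_sym p) (xi_at p)) Dxi.
Qed.

(** The common core of the contact CR, hemi-slant and pointwise hemi-slant cases,
    before the condition on the ambiguous distribution is added. *)
Lemma orth_decomposition_ptr D E : reeb_tangent M -> nonzero_distribution D ->
  orth_decomposition D E /\ totally_real D <->
  ptr D /\ (forall p, (E p :=: ambiguous D p)%MS).
Proof.
move=> hxi D0; split=> [[dec rD]|[[sD _ Dc rD] EA]].
  have DE := orth_decomposition_ambiguous dec.
  split; last by move=> p; have [] := DE p.
  by split=> // [|p]; [case: dec | have [] := DE p].
by split=> //; exact: ambiguous_orth_decomposition.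
Qed.

End AmbiguousDistribution.
Theorem proposition2p5 (R : realType) (m n : nat)
    (Mbar : sasakian_manifold R m) (M : immersed_submanifold n Mbar)
    (hxi : reeb_tangent M) :
  (* (1) anti-invariant submanifolds *)
  ((anti_invariant M -> nonzero_distribution (contact_part (M := M)) ->
      ptr (contact_part (M := M)) /\
      totally_real (ambiguous (contact_part (M := M)))) /\
   (forall Dperp : M -> 'M[R]_((2 * m).+1),
      smooth_distribution Dperp -> nonzero_distribution Dperp ->
      (forall p, (Dperp p <= contact_part p)%MS) ->
      (anti_invariant M <->
       ptr Dperp /\ totally_real (ambiguous Dperp)))) /\
  (* (2) contact CR-submanifolds *)
  (forall Dperp D : M -> 'M[R]_((2 * m).+1), nonzero_distribution Dperp ->
      (contact_CR Dperp D <->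
       [/\ ptr Dperp, (forall p, (D p :=: ambiguous Dperp p)%MS) &
           phi_invariant D])) /\
  (* (3) hemi-slant submanifolds *)
  (forall (Dperp D : M -> 'M[R]_((2 * m).+1)) (theta : R), nonzero_distribution Dperp ->
      (hemi_slant Dperp D theta <->
       [/\ ptr Dperp, (forall p, (D p :=: ambiguous Dperp p)%MS) &
           slant D theta])) /\
  (* (4) pointwise hemi-slant submanifolds *)
  (forall (Dperp D : M -> 'M[R]_((2 * m).+1)) (theta : M -> R), nonzero_distribution Dperp ->
      (pointwise_hemi_slant Dperp D theta <->
       [/\ ptr Dperp, (forall p, (D p :=: ambiguous Dperp p)%MS),
           pointwise_slant D theta & smooth_fun_on [set: M] theta])).
Proof.
split; [split|split; [|split]].
- move=> aM nz; split; last exact: totally_realS (ambiguous_contact _) aM.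
  by split=> //; exact: contact_part_smooth.
- move=> Dperp sD nzD Dc; split=> [aM|[[_ _ _ rD] rA] p].
    by split; [split=> //|]; apply: totally_realS aM => // p; exact: ambiguous_contact.
  apply: submx_trans (submxMr _ (contact_split (Dc p))) _.
  by rewrite addsmxMr addsmx_sub rD rA.
- move=> Dperp D nzD; have H := orth_decomposition_ptr D hxi nzD.
  split=> [[dec rD iD]|[pD DA iD]].
    by have [pD DA] := H.1 (conj dec rD).
  by have [dec rD] := H.2 (conj pD DA).
- move=> Dperp D theta nzD; have H := orth_decomposition_ptr D hxi nzD.
  split=> [[dec rD sD]|[pD DA sD]].
    by have [pD DA] := H.1 (conj dec rD).
  by have [dec rD] := H.2 (conj pD DA).
- move=> Dperp D theta nzD; have H := orth_decomposition_ptr D hxi nzD.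
  split=> [[dec rD sD sth]|[pD DA sD sth]].
    by have [pD DA] := H.1 (conj dec rD).
  by have [dec rD] := H.2 (conj pD DA).
Qed.
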